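(* Let $p$ be a prime, and let $P \in \mathbb{Z}_p[x, y]$ satisfy $P(0, 0) = 0$ and $\frac{\partial P}{\partial y}(0, 0) \not\equiv 0 \bmod p$. With $\hat Q$ and the automata $\mathcal{M}_{p^\alpha}$ (for $\alpha \geq 1$) as defined in the context, the inverse limit of the automata $\mathcal{M}_{p^\alpha}$ exists, and each state in the inverse limit is identified with an infinite sequence of base-$\frac{p}{\hat Q}$ digits.
   Context: $\mathbb{Z}_p$ denotes the $p$-adic integers. For $\alpha \geq 1$ write $\mathcal{R}_{p^\alpha} = \mathbb{Z}/p^\alpha\mathbb{Z}$. Let $\hat{Q} \in \mathbb{Z}_p[x, y, y^{-1}]$ be a lift of $P/y \bmod p$ having the same monomial support as $P/y \bmod p$. Cartier operators: for $r \in \{0, \dots, p-1\}$, $\Lambda_{r, 0}$ is the linear operator on Laurent polynomials with $\Lambda_{r, 0}(x^m y^n) = x^{(m - r)/p} y^{n/p}$ if $m \equiv r$ and $n \equiv 0 \bmod p$, and $0$ otherwise. For $S \in \mathcal{R}_{p^\alpha}[x, y, y^{-1}]$ put $\lambda^{(\alpha)}_{r, 0}(S) := \Lambda_{r, 0}\big(S\, (\hat Q \bmod p^\alpha)^{p^\alpha - p^{\alpha - 1}}\big)$. Automata: let $S_0^{(\alpha)} := \big(y \frac{\partial P}{\partial y} (P/y)^{p^{\alpha - 1} - 1} \bmod p^\alpha\big)$, and let $\mathcal{M}_{p^\alpha}$ be the smallest subset of $\mathcal{R}_{p^\alpha}[x, y, y^{-1}]$ that contains $S_0^{(\alpha)}$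 and is closed under $\lambda^{(\alpha)}_{r, 0}$ for all $r \in \{0, \dots, p-1\}$. It is viewed as the state set of an automaton with initial state $S_0^{(\alpha)}$ and with a transition labeled $r$ from $S$ to $\lambda^{(\alpha)}_{r,0}(S)$. Representations: let $D = \{0, 1, \dots, p-1\}$, viewed as a subset of each $\mathcal{R}_{p^\alpha}$, and let $D[x, y, y^{-1}]$ be the set of Laurent polynomials with all coefficients in $D$. Every $S \in \mathcal{M}_{p^\alpha}$ can be written uniquely as $S = \sum_{k = 0}^{\alpha - 1} T_k\, p^k (\hat Q \bmod p^\alpha)^{p^{\alpha - 1} - 1 - k}$ with all $T_k \in D[x, y, y^{-1}]$; the $T_k$ are the base-$\frac{p}{\hat Q}$ digits of $S$, and $(T_{\alpha - 1}, \dots, T_1, T_0)$ is its base-$\frac{p}{\hat Q}$ representation. The inverse limit is understood with respect to truncation of these representations, $(T_{\alpha - 1}, \dots, T_1, T_0) \mapsto (T_{\beta - 1}, \dots, T_1, T_0)$ for $\beta \leq \alpha$. *)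

(* Defs.v *)
From HB Require Import structures.
From mathcomp Require Import all_boot all_order all_algebra finmap.
From mathcomp Require Import boolp.
From mathcomp Require Import monalg.

Set Implicit Arguments.
Unset Strict Implicit.
Unset Printing Implicit Defensive.

Import GRing.Theory.
Local Open Scope ring_scope.

(* Levels are shifted by one: level n stands for alpha = n + 1, so that the   *)
(* levels range over nat, R_{p^alpha} is 'Z_(p ^ n.+1) (for p prime the       *)
(* modulus is then > 1, as 'Z_ requires), and p^(alpha - 1) is p ^ n.         *)

Section Padic.
Variable p : nat.

Definition Zp_red n (a : 'Z_(p ^ n.+2)) : 'Z_(p ^ n.+1) := (a : nat)%:R.

Definition padic_coherent (a : forall n, 'Z_(p ^ n.+1)) : Prop :=
  forall n, Zp_red (a n.+1) = a n.

(* The p-adic integers, as the limit of the rings Z/p^(n+1)Z; only meant for  *)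
(* p prime (it is a ring for every p, which spares a primality argument).     *)
Record padic := Padic {
  padic_val : forall n, 'Z_(p ^ n.+1);
  padic_valP : `[< padic_coherent padic_val >]
}.

HB.instance Definition _ := [isSub for padic_val].
HB.instance Definition _ := [Choice of padic by <:].

Definition padic_mod n (a : padic) : 'Z_(p ^ n.+1) := padic_val a n.

Lemma padicP (a b : padic) : (forall n, padic_mod n a = padic_mod n b) -> a = b.
Proof. by move=> ab; apply: val_inj; apply: functional_extensionality_dep. Qed.

Lemma padic_mod_red n (a : padic) : Zp_red (padic_mod n.+1 a) = padic_mod n a.
Proof. by move: (padic_valP a) => /asboolP; apply. Qed.

Lemma Zp_modulus_dvd n :
  ((Zp_trunc (p ^ n.+1)).+2 %| (Zp_trunc (p ^ n.+2)).+2)%N.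
Proof.
case: p => [|[|q]]; first by rewrite !exp0n.
  by rewrite !exp1n.
have gt1 k : (1 < q.+2 ^ k.+1)%N by rewrite -(exp1n k.+1) ltn_exp2r.
by rewrite !Zp_cast ?dvdn_exp2l.
Qed.

Lemma Zp_natr_mod n m :
  (m %% (Zp_trunc (p ^ n.+2)).+2)%:R = m%:R :> 'Z_(p ^ n.+1).
Proof.
by apply: val_inj; rewrite !Zp_nat /= modn_dvdm // Zp_modulus_dvd.
Qed.

Fact Zp_redD n : {morph @Zp_red n : a b / a + b}.
Proof. by move=> a b; rewrite /Zp_red /= Zp_natr_mod natrD. Qed.

Fact Zp_redM n : {morph @Zp_red n : a b / a * b}.
Proof. by move=> a b; rewrite /Zp_red /= Zp_natr_mod natrM. Qed.

Fact Zp_red0 n : @Zp_red n 0 = 0. Proof. by []. Qed.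

Fact Zp_red1 n : @Zp_red n 1 = 1. Proof. by rewrite /Zp_red /= Zp_natr_mod. Qed.

Fact Zp_redN n : {morph @Zp_red n : a / - a}.
Proof.
by move=> a; apply/eqP; rewrite -addr_eq0 -Zp_redD addNr Zp_red0.
Qed.

Fact padic0_subproof : `[< padic_coherent (fun=> 0) >].
Proof. by apply/asboolP => n; rewrite Zp_red0. Qed.
Definition padic0 := Padic padic0_subproof.

Fact padic1_subproof : `[< padic_coherent (fun=> 1) >].
Proof. by apply/asboolP => n; rewrite Zp_red1. Qed.
Definition padic1 := Padic padic1_subproof.

Fact padicD_subproof a b :
  `[< padic_coherent (fun n => padic_mod n a + padic_mod n b) >].
Proof. by apply/asboolP => n; rewrite Zp_redD !padic_mod_red. Qed.
Definition padicD a b := Padic (padicD_subproof a b).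

Fact padicN_subproof a : `[< padic_coherent (fun n => - padic_mod n a) >].
Proof. by apply/asboolP => n; rewrite Zp_redN padic_mod_red. Qed.
Definition padicN a := Padic (padicN_subproof a).

Fact padicM_subproof a b :
  `[< padic_coherent (fun n => padic_mod n a * padic_mod n b) >].
Proof. by apply/asboolP => n; rewrite Zp_redM !padic_mod_red. Qed.
Definition padicM a b := Padic (padicM_subproof a b).

Fact padicDA : associative padicD.
Proof. by move=> a b c; apply: padicP => n; apply: addrA. Qed.
Fact padicDC : commutative padicD.
Proof. by move=> a b; apply: padicP => n; apply: addrC. Qed.
Fact padic0D : left_id padic0 padicD.
Proof. by move=> a; apply: padicP => n; apply: add0r. Qed.
Fact padicND : left_inverse padic0 padicN padicD.
Proof. by move=> a; apply: padicP => n; apply: addNr. Qed.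

HB.instance Definition _ :=
  GRing.isZmodule.Build padic padicDA padicDC padic0D padicND.

Fact padicMA : associative padicM.
Proof. by move=> a b c; apply: padicP => n; apply: mulrA. Qed.
Fact padicMC : commutative padicM.
Proof. by move=> a b; apply: padicP => n; apply: mulrC. Qed.
Fact padic1M : left_id padic1 padicM.
Proof. by move=> a; apply: padicP => n; apply: mul1r. Qed.
Fact padicMDl : left_distributive padicM +%R.
Proof. by move=> a b c; apply: padicP => n; apply: mulrDl. Qed.
Fact padic1_neq0 : padic1 != 0.
Proof. by apply/eqP => /(congr1 (padic_mod 0)) /eqP; rewrite oner_eq0. Qed.

HB.instance Definition _ := GRing.Zmodule_isComNzRing.Build padic
  padicMA padicMC padic1M padicMDl padic1_neq0.

Fact padic_mod_is_zmod_morphism n : zmod_morphism (padic_mod n).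
Proof. by []. Qed.
HB.instance Definition _ n := GRing.isZmodMorphism.Build padic 'Z_(p ^ n.+1)
  (padic_mod n) (padic_mod_is_zmod_morphism n).

Fact padic_mod_is_monoid_morphism n : monoid_morphism (padic_mod n).
Proof. by []. Qed.
HB.instance Definition _ n := GRing.isMonoidMorphism.Build padic 'Z_(p ^ n.+1)
  (padic_mod n) (padic_mod_is_monoid_morphism n).

End Padic.

(* R[x, y, y^-1], as the monoid algebra of N x Z: S@_(m, n) is the            *)
(* coefficient of x^m y^n in S, and << c *g (m, n) >> is c x^m y^n. The       *)
(* product of monalg is restricted to monoids in which only 1 is invertible,  *)
(* hence the ring structure is given here.                                    *)
Definition laurent (R : comNzRingType) := {malg R[(nat * int)%type]}.

HB.instance Definition _ (R : comNzRingType) := GRing.Zmodule.on (laurent R).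

Section LaurentRing.
Variable R : comNzRingType.
Implicit Types (f g h : laurent R) (k l : (nat * int)%type).

Definition expD k l : (nat * int)%type := ((k.1 + l.1)%N, k.2 + l.2).

Definition laurent1 : laurent R := << 1 *g (0%N, 0) >>.

Definition laurentM f g : laurent R :=
  \sum_(k <- msupp f) \sum_(l <- msupp g) << f@_k * g@_l *g expD k l >>.

Local Open Scope fset_scope.

Lemma laurentMw (d1 d2 : {fset (nat * int)%type}) f g :
  msupp f `<=` d1 -> msupp g `<=` d2 ->
  laurentM f g =
    \sum_(k <- d1) \sum_(l <- d2) << f@_k * g@_l *g expD k l >>.
Proof.
move=> le1 le2; rewrite /laurentM (big_fset_incl _ le1) /=.
  apply/eq_bigr => k _; apply/big_fset_incl => // l _ /mcoeff_outdom ->.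
  by rewrite mulr0 monalgU0.
move=> k _ /mcoeff_outdom fk.
by rewrite big1 // => l _; rewrite fk mul0r monalgU0.
Qed.

Lemma laurentMC : commutative laurentM.
Proof.
move=> f g; rewrite /laurentM exchange_big; apply: eq_bigr => l _.
apply: eq_bigr => k _.
by rewrite mulrC /expD (addnC k.1) (addrC k.2).
Qed.

Lemma laurentMDl : left_distributive laurentM +%R.
Proof.
move=> f1 f2 g.
rewrite [in RHS](laurentMw (fsubsetUl _ (msupp f2)) (fsubset_refl _)).
rewrite [in RHS](laurentMw (fsubsetUr (msupp f1) _) (fsubset_refl _)).
rewrite (laurentMw (msuppD_le _ _) (fsubset_refl _)).
rewrite -big_split /=; apply/eq_bigr => k _.
rewrite -big_split /=; apply/eq_bigr => l _.
by rewrite mcoeffD mulrDl monalgUD.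
Qed.

Lemma laurentMDr : right_distributive laurentM +%R.
Proof. by move=> f g h; rewrite laurentMC laurentMDl !(laurentMC f). Qed.

Lemma laurent0M : left_zero 0 laurentM.
Proof. by move=> g; rewrite /laurentM msupp0 big_seq_fset0. Qed.

Lemma laurentM0 : right_zero 0 laurentM.
Proof. by move=> g; rewrite laurentMC laurent0M. Qed.

Lemma laurentMUU (a b : R) k l :
  laurentM << a *g k >> << b *g l >> = << a * b *g expD k l >>.
Proof. by rewrite (laurentMw msuppU_le msuppU_le) !big_seq_fset1 !mcoeffUU. Qed.

Lemma laurentMEl f g :
  laurentM f g = \sum_(k <- msupp f) laurentM << f@_k *g k >> g.
Proof.
rewrite {1}[f]monalgE.
exact: (big_morph (laurentM^~ g) (fun _ _ => laurentMDl _ _ _) (laurent0M g)).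
Qed.

Lemma laurentMEr f g :
  laurentM f g = \sum_(l <- msupp g) laurentM f << g@_l *g l >>.
Proof.
by rewrite laurentMC laurentMEl; apply: eq_bigr => l _; rewrite laurentMC.
Qed.

Lemma laurent1M : left_id laurent1 laurentM.
Proof.
move=> g; rewrite laurentMEr [RHS]monalgE; apply: eq_bigr => -[m n] _.
by rewrite laurentMUU mul1r /expD add0n add0r.
Qed.

Lemma laurentMA : associative laurentM.
Proof.
move=> f g h.
rewrite [RHS](_ : _ = \sum_(k <- msupp f)
    laurentM (laurentM << f@_k *g k >> g) h); last first.
  rewrite [laurentM f g]laurentMEl.
  exact: (big_morph (laurentM^~ h) (fun _ _ => laurentMDl _ _ _) (laurent0M h)).
rewrite laurentMEl; apply: eq_bigr => k _.
rewrite [RHS](_ : _ = \sum_(l <- msupp g)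
    laurentM (laurentM << f@_k *g k >> << g@_l *g l >>) h); last first.
  rewrite [laurentM _ g]laurentMEr.
  exact: (big_morph (laurentM^~ h) (fun _ _ => laurentMDl _ _ _) (laurent0M h)).
rewrite [laurentM g h]laurentMEl.
rewrite (big_morph (laurentM _) (fun _ _ => laurentMDr _ _ _) (laurentM0 _)).
apply: eq_bigr => l _.
rewrite [laurentM _ h]laurentMEr [RHS]laurentMEr.
rewrite (big_morph (laurentM _) (fun _ _ => laurentMDr _ _ _) (laurentM0 _)).
apply: eq_bigr => e _; rewrite !laurentMUU mulrA.
by rewrite /expD /= addnA addrA.
Qed.

Lemma laurent1_neq0 : laurent1 != 0.
Proof. by rewrite monalgU_eq0 oner_eq0. Qed.

HB.instance Definition _ := GRing.Zmodule_isComNzRing.Build (laurent R)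
  laurentMA laurentMC laurent1M laurentMDl laurent1_neq0.

End LaurentRing.

Definition laurent_map (R S : comNzRingType) (f : {rmorphism R -> S})
    (g : laurent R) : laurent S :=
  [malg k in msupp g => f g@_k].

(* Bivariate polynomials follow the convention of polyXY: in P, a polynomial  *)
(* in x over R[y], the coefficient of x^i y^j is P`_i`_j.                     *)
Definition laurent_of_poly (R : comNzRingType) (P : {poly {poly R}}) :
    laurent R :=
  \sum_(i < size P) \sum_(j < size P`_i) << P`_i`_j *g (nat_of_ord i, j%:Z) >>.

Definition dY (R : comNzRingType) (P : {poly {poly R}}) : {poly {poly R}} :=
  map_poly (@deriv R) P.

Definition laurent_y (R : comNzRingType) : laurent R := << 1 *g (0%N, 1) >>.

Definition poly_over_y (R : comNzRingType) (P : {poly {poly R}}) : laurent R :=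
  (<< 1 *g (0%N, -1) >> : laurent R) * laurent_of_poly P.

(* The Cartier operator Lambda_{r, 0}. *)
Definition cartier (p r : nat) (R : comNzRingType) (S : laurent R) :
    laurent R :=
  \sum_(k <- msupp S | (k.1 == r %[mod p])%N && (p%:Z %| k.2)%Z)
     << S@_k *g (((k.1 - r) %/ p)%N, (k.2 %/ p%:Z)%Z) >>.

(* Q lifts (P/y mod p), with the same monomial support. *)
Definition is_lift p (P : {poly {poly padic p}}) (Q : laurent (padic p)) :
    Prop :=
  let Py := laurent_map (padic_mod 0) (poly_over_y P) in
  laurent_map (padic_mod 0) Q = Py /\ msupp Q = msupp Py.

Section Automata.
Variables (p : nat) (P : {poly {poly padic p}}) (Q : laurent (padic p)).

Definition lambda n (r : 'I_p) (S : laurent 'Z_(p ^ n.+1)) :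
    laurent 'Z_(p ^ n.+1) :=
  cartier p r (S * laurent_map (padic_mod n) Q ^+ (p ^ n.+1 - p ^ n)).

Definition initial_poly n : laurent 'Z_(p ^ n.+1) :=
  laurent_map (padic_mod n)
    (laurent_y _ * laurent_of_poly (dY P) * poly_over_y P ^+ (p ^ n - 1)).

(* The set M_(p^(n+1)). *)
Inductive is_state n : laurent 'Z_(p ^ n.+1) -> Prop :=
| is_state_initial : is_state (initial_poly n)
| is_state_lambda r S : is_state S -> is_state (lambda r S).

(* The ring morphism int -> R views D as a subset of every R = Z/p^(n+1)Z.    *)
Definition digit_poly (T : laurent int) : Prop :=
  forall k, (0 <= T@_k < p%:Z)%R.

(* T k is the digit T_k, the coefficient of p^k.                              *)
Definition base_repr n (S : laurent 'Z_(p ^ n.+1))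
    (T : {ffun 'I_n.+1 -> laurent int}) : Prop :=
  (forall k, digit_poly (T k)) /\
  S = \sum_(k < n.+1) laurent_map intr (T k) * p%:R ^+ k *
                      laurent_map (padic_mod n) Q ^+ (p ^ n - 1 - k).

End Automata.

Record automaton (p : nat) := Automaton {
  state : Type;
  initial : state;
  next : 'I_p -> state -> state
}.

Record automaton_hom p (A B : automaton p) := AutomatonHom {
  hom_fun :> state A -> state B;
  hom_initial : hom_fun (initial A) = initial B;
  hom_next : forall r s, hom_fun (next r s) = next r (hom_fun s)
}.

Definition state_automaton p (P : {poly {poly padic p}}) (Q : laurent (padic p))
    (n : nat) : automaton p :=
  @Automaton p {S : laurent 'Z_(p ^ n.+1) | is_state P Q S}
    (exist _ _ (is_state_initial P Q n))
    (fun r s => exist _ _ (is_state_lambda r (proj2_sig s))).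

Definition is_inverse_system p (A : nat -> automaton p)
    (f : forall m n, (m <= n)%N -> automaton_hom (A n) (A m)) : Prop :=
  (forall n (le_nn : (n <= n)%N) s, f n n le_nn s = s) /\
  (forall l m n (le_lm : (l <= m)%N) (le_mn : (m <= n)%N) (le_ln : (l <= n)%N) s,
     f l m le_lm (f m n le_mn s) = f l n le_ln s).

Definition is_cone p (A : nat -> automaton p)
    (f : forall m n, (m <= n)%N -> automaton_hom (A n) (A m))
    (L : automaton p) (pi : forall n, automaton_hom L (A n)) : Prop :=
  forall m n (le_mn : (m <= n)%N) s, f m n le_mn (pi n s) = pi m s.

Definition is_inverse_limit p (A : nat -> automaton p)
    (f : forall m n, (m <= n)%N -> automaton_hom (A n) (A m))
    (L : automaton p) (pi : forall n, automaton_hom L (A n)) : Prop :=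
  is_cone f pi /\
  forall (B : automaton p) (g : forall n, automaton_hom B (A n)), is_cone f g ->
    exists u : automaton_hom B L,
      (forall n s, pi n (u s) = g n s) /\
      (forall v : automaton_hom B L,
         (forall n s, pi n (v s) = g n s) -> forall s, v s = u s).

Definition is_truncation p (P : {poly {poly padic p}}) (Q : laurent (padic p))
    m n (le_mn : (m <= n)%N)
    (f : state (state_automaton P Q n) -> state (state_automaton P Q m)) :
    Prop :=
  forall s (T : {ffun 'I_n.+1 -> laurent int}),
    base_repr Q (proj1_sig s) T ->
    base_repr Q (proj1_sig (f s))
      [ffun k : 'I_m.+1 => T (widen_ord (le_mn : (m.+1 <= n.+1)%N) k)].

(* Main.v *)
(* The element q = Q mod p^(n+1) is regular: its least exponent for the       *)
(* lexicographic order is (0, 0), whose coefficient is a unit, congruent to   *)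
(* dP/dy(0, 0). Since q^p = q(x^p, y^p) mod p, the span of the                *)
(* p^k q^(p^n - 1 - k) is stable under the Cartier step; it contains the      *)
(* initial state because P/y = Q mod p. Carrying produces the digits of an    *)
(* element of the span, and they are unique because q is regular.             *)
(* As p^n - 1 - k = (p^m - 1 - k) + (p^n - p^m), the truncation V of a state  *)
(* S is characterized by S = V q^(p^n - p^m) mod p^(m+1). This relation is    *)
(* compatible with the Cartier steps, because q^(p^(m+1)) and                 *)
(* q(x^p, y^p)^(p^m) agree mod p^(m+1); hence truncation is a morphism of     *)
(* automata, and the limit consists of the coherent families of states.       *)
From HB Require Import structures.
Require Import Defs.
From mathcomp Require Import all_boot all_order all_algebra.
From mathcomp Require Import finmap boolp monalg zify ring.

Set Implicit Arguments.
Unset Strict Implicit.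
Unset Printing Implicit Defensive.

Import Order.TTheory GRing.Theory Num.Theory.
Local Open Scope ring_scope.

(** * Laurent polynomials *)

(** Everything rests on two facts about q = Q mod p^(n+1). It can be cancelled ([lift_expI]), and
    Laurent polynomials congruent mod p have equal p^n-th powers mod p^(n+1) ([laurent_Zp_expp_eq]);
    the latter is applied to P/y and q, and to q^p and q(x^p, y^p). Digits: when P/y = q + pE and
    q^p = q(x^p, y^p) + pF are raised to powers by the binomial formula, each factor p gained costs
    one factor q. Hence every state stays in the span of the p^k q^(p^n - 1 - k) ([in_span_initial],
    [in_span_lambda]). Carrying turns coefficients into digits ([span_base_repr]), and cancelling q
    isolates the digits one by one ([base_repr_uniq]). Truncation from level n to level m amounts to
    dividing the state mod p^(m+1) by q^(p^n - p^m) ([reduces], [reduces_base_repr]). The equality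
    of powers makes this compatible with initial states and Cartier steps ([reduces_initial],
    [reduces_lambda]), so states reached by the same word correspond. The limit consists of the
    coherent sequences of states ([limit_is_inverse_limit]), whose digits extend one another into
    one infinite sequence ([limit_digits]) that determines them. *)

Section LaurentTheory.
Variable R : comNzRingType.
Implicit Types (f g : laurent R) (k l : (nat * int)%type).

Lemma laurentP f g : (forall k, f@_k = g@_k) -> f = g.
Proof. by move=> fg; apply/malgP. Qed.

Lemma laurent_ind (C : laurent R -> Prop) :
  (forall f g, C f -> C g -> C (f + g)) ->
  (forall a k, C << a *g k >>) -> forall f, C f.
Proof.
move=> CD CU f; rewrite [f]monalgE; elim/big_ind: _ => //.
by rewrite -(monalgU0 (0%N, 0 : int)); apply: CU.
Qed.

Lemma laurentMU (a b : R) k l :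
  (<< a *g k >> : laurent R) * << b *g l >> = << a * b *g expD k l >>.
Proof. exact: laurentMUU. Qed.

Lemma laurentD_coef f g k : (f + g)@_k = f@_k + g@_k.
Proof. exact: mcoeffD. Qed.

Lemma laurent_sum_coef (I : Type) (s : seq I) (F : I -> laurent R) k :
  (\sum_(i <- s) F i)@_k = \sum_(i <- s) (F i)@_k.
Proof. exact: (raddf_sum (mcoeff k)). Qed.

Lemma laurentMn_coef f n k : (f *+ n)@_k = f@_k *+ n.
Proof. exact: mcoeffMn. Qed.

Lemma laurent_natM_coef (n : nat) f k : (n%:R * f)@_k = n%:R * f@_k.
Proof. by rewrite mulr_natl laurentMn_coef mulr_natl. Qed.

Lemma laurentM_coef f g k :
  (f * g)@_k = \sum_(i <- msupp f) \sum_(j <- msupp g)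
     (f@_i * g@_j) *+ (expD i j == k).
Proof.
rewrite /GRing.mul /= /laurentM laurent_sum_coef; apply: eq_bigr => i _.
by rewrite laurent_sum_coef; apply: eq_bigr => j _; rewrite mcoeffU.
Qed.

Lemma laurentMU_coef f (a : R) k l :
  (f * << a *g k >>)@_(expD l k) = f@_l * a.
Proof.
elim/laurent_ind: f => [f g fE gE|b i].
  by rewrite mulrDl !laurentD_coef fE gE mulrDl.
rewrite laurentMU !mcoeffU mulrnAl; congr (_ *+ (nat_of_bool _)).
case: i l k => [i1 i2] [l1 l2] [k1 k2].
by rewrite /expD !xpair_eqE /= eqn_add2r (inj_eq (addIr _)).
Qed.

(** The exponents of x are naturals, so the shift by [k.1] needs a bound, whereas the integer
    exponents of y shift freely. *)
Lemma laurentMU_coef_if f (a : R) k (i : nat) (j : int) :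
  (f * << a *g k >>)@_(i, j) =
  if (k.1 <= i)%N then f@_((i - k.1)%N, j - k.2) * a else 0.
Proof.
case: (leqP k.1 i) => [le_ki|lt_ik].
  have {1}-> : (i, j) = expD ((i - k.1)%N, j - k.2) k.
    by rewrite /expD /= subnK // subrK.
  exact: laurentMU_coef.
rewrite laurentM_coef big1_seq // => l _; apply: big1_seq => m /= ml.
have /(fsubsetP msuppU_le) := ml; rewrite inE => /eqP ->.
case: eqP => // -[e _]; exfalso; lia.
Qed.
End LaurentTheory.

Section LaurentMap.
Variables (R S : comNzRingType) (f : {rmorphism R -> S}).

Lemma laurent_map_coef g k : (laurent_map f g)@_k = f g@_k.
Proof.
rewrite mcoeffE; case: ifPn => // /mcoeff_outdom ->.
by rewrite rmorph0.
Qed.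

Fact laurent_map_is_zmod_morphism : zmod_morphism (laurent_map f).
Proof.
move=> g h; apply: laurentP => k.
rewrite laurent_map_coef; rewrite [RHS]mcoeffB !laurent_map_coef.
by rewrite [in LHS]mcoeffB rmorphB.
Qed.

HB.instance Definition _ := GRing.isZmodMorphism.Build (laurent R) (laurent S)
  (laurent_map f) laurent_map_is_zmod_morphism.

Lemma laurent_mapU a k : laurent_map f << a *g k >> = << f a *g k >>.
Proof.
by apply: laurentP => l; rewrite laurent_map_coef !mcoeffU rmorphMn.
Qed.

Lemma laurent_mapD g h :
  laurent_map f (g + h) = laurent_map f g + laurent_map f h.
Proof. exact: raddfD. Qed.

Fact laurent_map_is_monoid_morphism : monoid_morphism (laurent_map f).
Proof.
split; first by rewrite [LHS]laurent_mapU rmorph1.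
elim/laurent_ind => [g1 g2 e1 e2 h|a k].
  by rewrite mulrDl !laurent_mapD mulrDl e1 e2.
elim/laurent_ind => [h1 h2 e1 e2|b l].
  by rewrite mulrDr !laurent_mapD mulrDr e1 e2.
by rewrite !laurentMU !laurent_mapU laurentMU rmorphM.
Qed.

HB.instance Definition _ :=
  GRing.isMonoidMorphism.Build (laurent R) (laurent S)
    (laurent_map f) laurent_map_is_monoid_morphism.

Lemma laurent_mapM g h :
  laurent_map f (g * h) = laurent_map f g * laurent_map f h.
Proof. exact: rmorphM. Qed.

Lemma laurent_mapX g n : laurent_map f (g ^+ n) = laurent_map f g ^+ n.
Proof. exact: rmorphXn. Qed.

Lemma laurent_map_sum (I : Type)
    (s : seq I) (F : I -> laurent R) :
  laurent_map f (\sum_(i <- s) F i) = \sum_(i <- s) laurent_map f (F i).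
Proof. exact: (raddf_sum (laurent_map f)). Qed.

Lemma laurent_mapMX g h e :
  laurent_map f (g * h ^+ e) = laurent_map f g * laurent_map f h ^+ e.
Proof. by rewrite laurent_mapM laurent_mapX. Qed.

Lemma laurent_map_term g h m i e :
  laurent_map f (g * m%:R ^+ i * h ^+ e) =
  laurent_map f g * m%:R ^+ i * laurent_map f h ^+ e.
Proof. by rewrite !laurent_mapMX rmorph_nat. Qed.
End LaurentMap.

(** * The substitution of (x^p, y^p) and the Cartier operators *)

Section Cartier.
Variables (p : nat) (p_gt0 : (0 < p)%N).

(** This is f(x^p, y^p), which approximates f^p mod p and which factors out of the Cartier
    operators. *)
Definition laurent_subst (R : comNzRingType) (f : laurent R) : laurent R :=
  \sum_(k <- msupp f) << f@_k *g ((p * k.1)%N, p%:Z * k.2) >>.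

Section OneRing.
Variables (R : comNzRingType) (r : 'I_p).
Implicit Types f g : laurent R.

Lemma laurent_subst_coef f k :
  (laurent_subst f)@_((p * k.1)%N, p%:Z * k.2) = f@_k.
Proof.
rewrite /laurent_subst [in RHS](monalgE f) !laurent_sum_coef.
apply: eq_bigr => l _.
rewrite !mcoeffU; congr (_ *+ (nat_of_bool _)).
case: l k => [l1 l2] [k1 k2]; rewrite !xpair_eqE /= eqn_pmul2l //.
by rewrite (inj_eq (mulfI _)) //; lia.
Qed.

Lemma laurent_subst_coef0 f k :
    ~~ ((p %| k.1)%N && (p%:Z %| k.2)%Z) ->
  (laurent_subst f)@_k = 0.
Proof.
move=> kN; rewrite /laurent_subst laurent_sum_coef big1 // => l _.
rewrite mcoeffU; case: eqP => // kE; case/negP: kN; rewrite -kE /=.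
by rewrite dvdn_mulr // dvdz_mulr.
Qed.

Lemma laurent_substD f g :
  laurent_subst (f + g) = laurent_subst f + laurent_subst g.
Proof.
apply: laurentP => -[k1 k2]; rewrite laurentD_coef.
have [|kN] := boolP ((p %| k1)%N && (p%:Z %| k2)%Z).
  case/andP=> /dvdnP[a ->] /dvdzP[b ->]; rewrite (mulnC a) (mulrC b).
  by rewrite !(laurent_subst_coef _ (a, b)) laurentD_coef.
by rewrite !laurent_subst_coef0 // addr0.
Qed.

Lemma laurent_substU (a : R) k :
  laurent_subst << a *g k >> = << a *g ((p * k.1)%N, p%:Z * k.2) >>.
Proof.
rewrite /laurent_subst msuppU; case: eqP => [->|_].
  by rewrite big_seq_fset0 monalgU0.
by rewrite big_seq_fset1 mcoeffUU.
Qed.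

(** Since r < p, an exponent congruent to r is r plus p times its quotient, so the truncated
    subtraction in [cartier] is exact. Linearity and compatibility with ring morphisms are read off
    from this formula. *)
Lemma cartier_coef f k :
  (cartier p r f)@_k = f@_((p * k.1 + r)%N, p%:Z * k.2).
Proof.
rewrite /cartier big_mkcond /= [in RHS](monalgE f) !laurent_sum_coef.
apply: eq_bigr => -[l1 l2] _; case: ifP => /= [/andP[l1r]|lN].
  move=> /dvdzP[b bE]; rewrite !mcoeffU; congr (_ *+ (nat_of_bool _)).
  have r_lt := ltn_ord r.
  have := divn_eq l1 p; move: l1r; rewrite (modn_small r_lt) => /eqP -> l1E.
  have -> : (l1 - r = l1 %/ p * p)%N by rewrite {1}l1E addnK.
  rewrite mulnK // {}bE.
  rewrite mulzK; last lia.
  case: k => k1 k2; rewrite !xpair_eqE /= (mulrC b).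
  rewrite (inj_eq (mulfI _)) //; last lia.
  congr (_ && _); rewrite {2}l1E eqn_add2r mulnC eqn_pmul2l //.
rewrite mcoeff0 mcoeffU; case: eqP => // -[k1E k2E]; move: lN.
rewrite k1E k2E dvdz_mulr // andbT mulnC modnMDl modn_small //.
by rewrite eqxx.
Qed.

Fact cartier_is_zmod_morphism : zmod_morphism (@cartier p r R).
Proof.
move=> f g; apply: laurentP => k; rewrite cartier_coef.
by rewrite [RHS]mcoeffB !cartier_coef [LHS]mcoeffB.
Qed.

HB.instance Definition _ := GRing.isZmodMorphism.Build (laurent R) (laurent R)
  (@cartier p r R) cartier_is_zmod_morphism.

Lemma cartierD f g : cartier p r (f + g) = cartier p r f + cartier p r g.
Proof. exact: raddfD. Qed.

(** By bilinearity both factors may be monomials; a monomial in x^p and y^p shifts the quotients of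
    the exponents and keeps their residues. *)
Lemma cartierM_subst f g :
  cartier p r (f * laurent_subst g) = cartier p r f * g.
Proof.
elim/laurent_ind: g => [g1 g2 e1 e2|b l].
  by rewrite laurent_substD !(mulrDr _ _) cartierD; apply: (congr2 +%R e1 e2).
rewrite laurent_substU; elim/laurent_ind: f => [f1 f2 e1 e2|a k].
  by rewrite cartierD (mulrDl f1) cartierD e1 e2 -mulrDl.
apply: laurentP => -[m1 m2]; rewrite laurentMU cartier_coef mcoeffU.
rewrite laurentMU_coef_if; case: ifP => [le_lm|lt_ml].
  rewrite cartier_coef mcoeffU mulrnAl; congr (_ *+ (nat_of_bool _)).
  by case: k l le_lm => [k1 k2] [l1 l2] /= le; rewrite /expD !xpair_eqE /=; nia.
(* Here m1 < l.1, hence p * m1 + r < p * l.1: the exponent of x is too small for the product. *)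
case: eqP => // -[] e _; exfalso; have := ltn_ord r; nia.
Qed.

Lemma cartierM_substX f g e :
  cartier p r (f * laurent_subst g ^+ e) = cartier p r f * g ^+ e.
Proof.
elim: e f => [|e IH] f; first by rewrite !expr0 !mulr1.
by rewrite !exprSr !mulrA cartierM_subst IH.
Qed.
End OneRing.

Lemma cartier_natM (R : comNzRingType) (r : 'I_p) (m : nat) (f : laurent R) :
  cartier p r (m%:R * f) = m%:R * cartier p r f.
Proof.
apply: laurentP => k.
by rewrite laurent_natM_coef !cartier_coef laurent_natM_coef.
Qed.

Lemma cartier_sum (R : comNzRingType) (r : 'I_p) (I : Type) (s : seq I)
    (F : I -> laurent R) :
  cartier p r (\sum_(i <- s) F i) = \sum_(i <- s) cartier p r (F i).
Proof. exact: (raddf_sum (@cartier p r R)). Qed.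

Lemma cartier_natXM (R : comNzRingType) (r : 'I_p) k (f : laurent R) :
  cartier p r (p%:R ^+ k * f) = p%:R ^+ k * cartier p r f.
Proof. by rewrite -natrX cartier_natM. Qed.

Lemma cartier_map (R S : comNzRingType) (h : {rmorphism R -> S}) (r : 'I_p) f :
  laurent_map h (cartier p r f) = cartier p r (laurent_map h f).
Proof.
apply: laurentP => k.
by rewrite laurent_map_coef !cartier_coef laurent_map_coef.
Qed.

End Cartier.

(** * Congruences modulo a natural number *)

Section NatDivides.
Variable A : comNzRingType.
Implicit Types (m : nat) (x y : A).

(** Congruences are written as divisibility of a difference, in the same way for coefficients and
    for Laurent polynomials. *)
Definition nat_dvd m x : Prop := exists e, x = m%:R * e.

Lemma nat_dvd_nat m : nat_dvd m m%:R.
Proof. by exists 1; rewrite mulr1. Qed.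

Lemma nat_dvdD m x y : nat_dvd m x -> nat_dvd m y -> nat_dvd m (x + y).
Proof. by move=> [e ->] [f ->]; exists (e + f); rewrite mulrDr. Qed.

Lemma nat_dvdMr m x y : nat_dvd m x -> nat_dvd m (x * y).
Proof. by move=> [e ->]; exists (e * y); rewrite mulrA. Qed.

Lemma nat_dvd0 m : nat_dvd m 0.
Proof. by exists 0; rewrite mulr0. Qed.

Lemma nat_dvd_sum m (I : Type) (s : seq I) (C : pred I) (F : I -> A) :
  (forall i, C i -> nat_dvd m (F i)) -> nat_dvd m (\sum_(i <- s | C i) F i).
Proof.
by move=> CF; elim/big_ind: _ => //; [apply: nat_dvd0 | apply: nat_dvdD].
Qed.

Lemma nat_dvd_subD m x y z s t :
  nat_dvd m (x - (y + z)) -> nat_dvd m (y - s) -> nat_dvd m (z - t) ->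
  nat_dvd m (x - (s + t)).
Proof.
move=> xyz ys zt; have -> : x - (s + t) = x - (y + z) + (y - s + (z - t)).
  by rewrite (addrACA y) -opprD addrA subrK.
by apply: nat_dvdD => //; apply: nat_dvdD.
Qed.

Lemma nat_dvdM m n x y : nat_dvd m x -> nat_dvd n y -> nat_dvd (m * n) (x * y).
Proof. by move=> [e ->] [f ->]; exists (e * f); rewrite natrM mulrACA. Qed.

Lemma nat_dvd_subX m x y e : nat_dvd m (x - y) -> nat_dvd m (x ^+ e - y ^+ e).
Proof. by move=> xy; rewrite subrXX; apply: nat_dvdMr. Qed.

Lemma nat_dvd_trans d m x : (d %| m)%N -> nat_dvd m x -> nat_dvd d x.
Proof.
move=> /dvdnP[c ->] [e ->]; exists (c%:R * e).
by rewrite mulnC natrM mulrA.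
Qed.

(** In x^p - y^p = (x - y) * (sum of the x^(p-1-i) y^i), the second factor is congruent to p y^(p-1)
    mod p, hence gives one more factor p. *)
Lemma nat_dvd_subXp p j x y : (0 < p)%N ->
  nat_dvd (p ^ j.+1) (x - y) -> nat_dvd (p ^ j.+2) (x ^+ p - y ^+ p).
Proof.
move=> p_gt0 xy; rewrite subrXX expnSr; apply: nat_dvdM => //.
have -> : \sum_(i < p) x ^+ (p.-1 - i) * y ^+ i =
  \sum_(i < p) (x ^+ (p.-1 - i) - y ^+ (p.-1 - i)) * y ^+ i
  + p%:R * y ^+ p.-1.
  have -> : p%:R * y ^+ p.-1 = \sum_(i < p) y ^+ p.-1.
    by rewrite sumr_const card_ord mulr_natl.
  rewrite -big_split /=.
  apply: eq_bigr => i _; rewrite mulrBl -exprD subnK ?subrK //.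
  by rewrite -ltnS prednK.
apply: nat_dvdD; last exact/nat_dvdMr/nat_dvd_nat.
apply: nat_dvd_sum => i _; apply/nat_dvdMr/nat_dvd_subX.
by apply: nat_dvd_trans xy; rewrite expnS dvdn_mulr.
Qed.

Lemma nat_dvd_subXpn p n x y : (0 < p)%N ->
  nat_dvd p (x - y) -> nat_dvd (p ^ n.+1) (x ^+ (p ^ n) - y ^+ (p ^ n)).
Proof.
move=> p_gt0 xy; elim: n => [|n IH]; first by rewrite expn1 expn0 !expr1.
by rewrite (expnSr p n) !exprM; apply: nat_dvd_subXp.
Qed.

Lemma nat_dvd_Frobenius p x y : prime p ->
  nat_dvd p ((x + y) ^+ p - (x ^+ p + y ^+ p)).
Proof.
case: p => [//|[//|q]] p_pr; rewrite exprDn big_ord_recl big_ord_recr.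
have bumpE k : bump 0 k = k.+1 by [].
rewrite /= !bumpE subnn subn0 !expr0 bin0 binn mul1r mulr1 !mulr1n.
rewrite opprD addrACA subrr add0r addrK.
apply: nat_dvd_sum => i _; rewrite bumpE -mulr_natl; apply: nat_dvdMr.
apply: nat_dvd_trans (nat_dvd_nat _); apply: prime_dvd_bin => //.
by have := ltn_ord i; lia.
Qed.
End NatDivides.

Section LaurentNatDivides.
Variable R : comNzRingType.
Implicit Types f g : laurent R.

Lemma laurent_nat_dvd m f : (forall k, nat_dvd m f@_k) -> nat_dvd m f.
Proof.
move=> fm; rewrite [f]monalgE; apply: nat_dvd_sum => k _.
have [e ->] := fm k; exists << e *g k >>.
by rewrite !mulr_natl monalgUMn.
Qed.

Lemma laurentXU (a : R) k m :
  (<< a *g k >> : laurent R) ^+ m = << a ^+ m *g ((m * k.1)%N, m%:Z * k.2) >>.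
Proof.
elim: m => [|m IH]; first by rewrite !expr0 mul0n mul0r.
rewrite !exprS IH laurentMU /expD /=; congr (mkmalgU (_, _) _).
by rewrite intS mulrDl mul1r.
Qed.

(** The p-th power is additive mod p, which leaves the monomials, where the assumption on the
    coefficients applies. *)
Lemma nat_dvd_laurent_subst p f : prime p ->
  (forall a : R, nat_dvd p (a ^+ p - a)) ->
  nat_dvd p (f ^+ p - laurent_subst p f).
Proof.
move=> p_pr Rp; have p_gt0 := prime_gt0 p_pr.
elim/laurent_ind: f => [f g fp gp|a k].
  rewrite (laurent_substD p_gt0).
  exact: nat_dvd_subD (nat_dvd_Frobenius f g p_pr) fp gp.
rewrite laurentXU laurent_substU; apply: laurent_nat_dvd => l.
rewrite mcoeffB !mcoeffU -mulrnBl.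
by case: (_ == _); [rewrite mulr1n; apply: Rp | apply: nat_dvd0].
Qed.
End LaurentNatDivides.

(** * The rings Z/p^(n+1) *)

Section ZpPrimePower.
Variables (p : nat) (p_pr : prime p).

Lemma prime_powS_gt1 n : (1 < p ^ n.+1)%N.
Proof. by rewrite -(exp1n n.+1) ltn_exp2r // prime_gt1. Qed.

Lemma Zp_nat_eq0 n m : (m%:R == 0 :> 'Z_(p ^ n.+1)) = (p ^ n.+1 %| m)%N.
Proof. by rewrite -val_eqE /= val_Zp_nat ?prime_powS_gt1. Qed.

Lemma Zp_pow_eq0 n : (p ^ n.+1)%:R = 0 :> 'Z_(p ^ n.+1).
Proof. by apply/eqP; rewrite Zp_nat_eq0. Qed.

Lemma nat_dvd_Zp_expp n (a : 'Z_(p ^ n.+1)) : nat_dvd p (a ^+ p - a).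
Proof.
rewrite -(natr_Zp a) -natrX.
(* Fermat's little theorem is used on representatives, whose difference is taken in [nat]. *)
have le_a : (a <= a ^ p)%N.
  case: (nat_of_ord a) => [//|b].
  by rewrite -{1}(expn1 b.+1) leq_pexp2l // prime_gt0.
rewrite -natrB //; apply: nat_dvd_trans (nat_dvd_nat _ _).
by rewrite -eqn_mod_dvd //; apply/eqP/fermat_little.
Qed.

Lemma laurent_Zp_pow_nat_dvd n (f : laurent 'Z_(p ^ n.+1)) :
  nat_dvd (p ^ n.+1) f -> f = 0.
Proof.
move=> [e ->]; apply: laurentP => k.
by rewrite laurent_natM_coef Zp_pow_eq0 mul0r mcoeff0.
Qed.

Lemma laurent_Zp_expp_eq n (f g : laurent 'Z_(p ^ n.+1)) :
  nat_dvd p (f - g) -> f ^+ (p ^ n) = g ^+ (p ^ n).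
Proof.
move=> fg; apply/eqP; rewrite -subr_eq0; apply/eqP/laurent_Zp_pow_nat_dvd.
exact/nat_dvd_subXpn/fg/prime_gt0.
Qed.

Lemma nat_dvd_Zp_subst n (f : laurent 'Z_(p ^ n.+1)) :
  nat_dvd p (f ^+ p - laurent_subst p f).
Proof. by apply: nat_dvd_laurent_subst => // a; apply: nat_dvd_Zp_expp. Qed.

Section Projection.
Variables (m n : nat) (le_mn : (m <= n)%N).

(* The proof arguments let the ring morphism structure be inferred.           *)
Definition Zp_proj (_ : prime p) (_ : (m <= n)%N) (a : 'Z_(p ^ n.+1)) :
    'Z_(p ^ m.+1) :=
  (a : nat)%:R.

Lemma Zp_proj_nat i : Zp_proj p_pr le_mn i%:R = i%:R.
Proof.
apply: ord_inj; rewrite /Zp_proj !val_Zp_nat ?prime_powS_gt1 //.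
by rewrite modn_dvdm // dvdn_exp2l.
Qed.

Fact Zp_proj_is_zmod_morphism : zmod_morphism (Zp_proj p_pr le_mn).
Proof.
move=> a b; apply/eqP; rewrite -(inj_eq (addIr (Zp_proj p_pr le_mn b))) subrK.
rewrite -{1}(natr_Zp (a - b)) -{2}(natr_Zp b) !Zp_proj_nat -natrD -Zp_proj_nat.
by rewrite natrD !natr_Zp subrK.
Qed.

HB.instance Definition _ :=
  GRing.isZmodMorphism.Build 'Z_(p ^ n.+1) 'Z_(p ^ m.+1) (Zp_proj p_pr le_mn)
    Zp_proj_is_zmod_morphism.

Fact Zp_proj_is_monoid_morphism : monoid_morphism (Zp_proj p_pr le_mn).
Proof.
split; first exact: (Zp_proj_nat 1).
move=> a b; rewrite -{1}(natr_Zp a) -{1}(natr_Zp b) -natrM Zp_proj_nat natrM.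
by [].
Qed.

HB.instance Definition _ :=
  GRing.isMonoidMorphism.Build 'Z_(p ^ n.+1) 'Z_(p ^ m.+1) (Zp_proj p_pr le_mn)
    Zp_proj_is_monoid_morphism.

End Projection.

Lemma Zp_proj_id n (le_nn : (n <= n)%N) a : Zp_proj p_pr le_nn a = a.
Proof. exact: natr_Zp. Qed.

Lemma Zp_proj_comp l m n (le_lm : (l <= m)%N) (le_mn : (m <= n)%N)
    (le_ln : (l <= n)%N) a :
  Zp_proj p_pr le_lm (Zp_proj p_pr le_mn a) = Zp_proj p_pr le_ln a.
Proof. exact: Zp_proj_nat. Qed.

Lemma Zp_proj_padic m n (le_mn : (m <= n)%N) (a : padic p) :
  Zp_proj p_pr le_mn (padic_mod n a) = padic_mod m a.
Proof.
elim: n le_mn => [|n IH] le_mn.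
  by case: m le_mn => // le_mn; apply: Zp_proj_id.
have [lt_mn|lt_nm] := leqP m n; last first.
  have mE : m = n.+1 by lia.
  by subst m; apply: Zp_proj_id.
rewrite -(Zp_proj_comp lt_mn (leqnSn n)) -(IH lt_mn).
by rewrite -[padic_mod n a]padic_mod_red.
Qed.

(** [is_lift] compares residues at level 0 only; this turns them into congruences mod p at every
    level. *)
Lemma Zp_proj0_eq0 n (a : 'Z_(p ^ n.+1)) :
  Zp_proj p_pr (leq0n n) a = 0 -> nat_dvd p a.
Proof.
move=> /eqP; rewrite Zp_nat_eq0 expn1 => /dvdnP[c ac].
by exists c%:R; rewrite -natrM mulnC -ac natr_Zp.
Qed.
End ZpPrimePower.

(* Lexicographically, (0, 0) is the least exponent of q, so the coefficients  *)
(* of f vanish one after the other, in lexicographic order.                   *)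
Lemma laurent_lexi_mulI (R : comUnitRingType) (q f : laurent R) :
  q@_(0%N, 0) \is a GRing.unit -> (forall j : int, j < 0 -> q@_(0%N, j) = 0) ->
  f * q = 0 -> f = 0.
Proof.
move=> q0 qneg fq0.
(* The integer exponents of y are not well-founded; a lower bound b on the support of f gives the
   inner induction on j a start. *)
have [b b_le] : exists b : int, forall k, k \in msupp f -> b <= k.2.
  exists (- (\max_(k <- msupp f) `|k.2|%N)%:Z) => k kf.
  have : (`|k.2| <= \max_(l <- msupp f) `|l.2|)%N.
    exact: (leq_bigmax_seq (F := fun l => `|l.2|%N)).
  by set m := bigop.body _ _ _; lia.
suff f0 i j : f@_(i, j) = 0 by apply: laurentP => -[i j]; rewrite f0 mcoeff0.
elim/ltn_ind: i j => i IHi j.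
have f_lt (j0 : int) : j0 < b -> f@_(i, j0) = 0.
  move=> jb; apply: mcoeff_outdom; apply/negP => /b_le /=; lia.
have [d] := ubnP `|j - b|%N; elim: d j => // d IHd j jd.
have [|bj] := ltrP j b; first exact: f_lt.
have IHj j' : j' < j -> f@_(i, j') = 0.
  move=> j'j; have [j'b|bj'] := ltrP j' b; last by apply: IHd => //; lia.
  by apply: mcoeff_outdom; apply/negP => /b_le /=; lia.
(* In the coefficient of x^i y^j in f * q, every term but f@_(i, j) * q@_(0, 0) vanishes: it
   involves a smaller exponent of f, or an exponent of q below (0, 0). *)
apply: (mulIr q0); rewrite mul0r.
have <- : (f * q)@_(i, j) = 0 by rewrite fq0 mcoeff0.
rewrite [in RHS](monalgE f) {1}(monalgE f) mulr_suml.
rewrite !laurent_sum_coef mulr_suml.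
apply: eq_bigr => k _; rewrite mulrC [(<< _ *g k >> : laurent R) * q]mulrC.
rewrite laurentMU_coef_if mcoeffU; case: eqP => [->|kij].
  by rewrite leqnn subnn subrr mulr1n.
rewrite mulr0n mulr0; case: leqP => // le_ki.
have [lt_ki|le_ik] := ltnP k.1 i.
  by case: k lt_ki {kij le_ki} => k1 k2 ?; rewrite IHi ?mulr0.
have k1E : k.1 = i by apply/eqP; rewrite eqn_leq le_ki le_ik.
rewrite k1E subnn; have [|le_kj] := ltrP (j - k.2) 0.
  by move=> /qneg ->; rewrite mul0r.
case: k k1E kij {le_ki le_ik} le_kj => k1 k2 /= -> kij le_kj.
rewrite IHj ?mulr0 // lt_neqAle; apply/andP; split; last lia.
by apply/eqP => k2E; apply: kij; rewrite k2E.
Qed.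

(** * Coefficients of P and P/y *)

Section PolyCoefficients.
Variable R : comNzRingType.
Implicit Type P : {poly {poly R}}.

Lemma laurent_of_poly_coef P (i j : nat) :
  (laurent_of_poly P)@_(i, j%:Z) = P`_i`_j.
Proof.
rewrite /laurent_of_poly laurent_sum_coef.
under eq_bigr do rewrite laurent_sum_coef.
have [le_Pi|lt_iP] := leqP (size P) i.
  rewrite (nth_default 0 le_Pi) coef0 big1 // => k _; rewrite big1 // => l _.
  rewrite mcoeffU; case: eqP => // -[ki _]; exfalso.
  by move: (ltn_ord k); rewrite ki ltnNge le_Pi.
rewrite (bigD1 (Ordinal lt_iP)) //= addrC big1 ?add0r => [|k ki]; last first.
  rewrite big1 // => l _; rewrite mcoeffU; case: eqP => // -[kE _].
  by case/eqP: ki; apply: val_inj.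
have [le_Pj|lt_jP] := leqP (size P`_i) j.
  rewrite (nth_default 0 le_Pj) big1 // => l _.
  rewrite mcoeffU; case: eqP => // -[lj]; exfalso.
  by move: (ltn_ord l); rewrite lj ltnNge le_Pj.
rewrite (bigD1 (Ordinal lt_jP)) //= big1 ?addr0 ?mcoeffUU // => l lj.
rewrite mcoeffU; case: eqP => // -[lE].
by case/eqP: lj; apply: val_inj.
Qed.

Lemma laurent_of_poly_coef_neg P i (j : int) :
  j < 0 -> (laurent_of_poly P)@_(i, j) = 0.
Proof.
move=> j0; rewrite /laurent_of_poly laurent_sum_coef big1 // => k _.
rewrite laurent_sum_coef big1 // => l _; rewrite mcoeffU.
by case: eqP => // -[_ lj]; lia.
Qed.

Lemma poly_over_y_coef P i (j : int) :
  (poly_over_y P)@_(i, j) = (laurent_of_poly P)@_(i, j + 1).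
Proof.
by rewrite /poly_over_y mulrC laurentMU_coef_if /= subn0 opprK mulr1.
Qed.
End PolyCoefficients.

(** * Identities between powers, and carrying, in a commutative ring *)

Lemma mul_binomial_term (A : comNzRingType) (c q x e : A) i j b :
  c * (q ^+ j * (x * e) ^+ i *+ b) = (c * e ^+ i *+ b) * x ^+ i * q ^+ j.
Proof.
rewrite exprMn !(mulrnAl, mulrnAr); congr (_ *+ _).
by rewrite mulrCA [RHS]mulrC; congr (_ * _); rewrite mulrCA mulrC.
Qed.

Lemma mul_exp_split (A : comNzRingType) (u q : A) a b c d e :
  (a + b = c + d * e)%N -> u * q ^+ a * q ^+ b = u * q ^+ c * (q ^+ d) ^+ e.
Proof. by move=> abE; rewrite -!mulrA -exprM -!exprD abE. Qed.

Lemma expn_sub_split p m n : (m <= n)%N ->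
  (p ^ n - p ^ m = p ^ m * (p ^ (n - m) - 1))%N.
Proof. by move=> le_mn; rewrite mulnBr -expnD subnKC // muln1. Qed.

(** For y = P/y mod p^(m+1): p^n - 1 = (p^m - 1) + (p^n - p^m), and p^m divides the last summand, so
    that y may be replaced by q there. *)
Lemma mul_exp_initial (A : comNzRingType) (c y q : A) p m n :
  (0 < p)%N -> (m <= n)%N -> y ^+ (p ^ m) = q ^+ (p ^ m) ->
  c * y ^+ (p ^ n - 1) = c * y ^+ (p ^ m - 1) * q ^+ (p ^ n - p ^ m).
Proof.
move=> p_gt0 le_mn yq; rewrite [in RHS](expn_sub_split p le_mn) exprM -yq.
rewrite -exprM -expn_sub_split // -mulrA -exprD; congr (_ * _ ^+ _).
have := leq_pexp2l p_gt0 le_mn; have : (0 < p ^ m)%N by rewrite expn_gt0 p_gt0.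
lia.
Qed.

(** For y = q and s = q(x^p, y^p): the total exponent p^(n+1) - p^m of y is (p^(m+1) - p^m) + p (p^n
    - p^m), and the last summand is a multiple of p^(m+1). *)
Lemma mul_exp_lambda (A : comNzRingType) (v y s : A) p m n :
  (0 < p)%N -> (m <= n)%N -> (y ^+ p) ^+ (p ^ m) = s ^+ (p ^ m) ->
  v * y ^+ (p ^ n - p ^ m) * y ^+ (p ^ n.+1 - p ^ n) =
  v * y ^+ (p ^ m.+1 - p ^ m) * s ^+ (p ^ n - p ^ m).
Proof.
move=> p_gt0 le_mn ys; rewrite [in RHS](expn_sub_split p le_mn) exprM -ys.
rewrite -!exprM -!mulrA -!exprD; congr (_ * _ ^+ _).
rewrite -expn_sub_split // mulnBr -!expnS.
have := leq_pexp2l p_gt0 le_mn; have := leq_pexp2l p_gt0 (leqnSn n).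
have := leq_pexp2l p_gt0 (leqnSn m).
have := leq_pexp2l p_gt0 (le_mn : (m < n.+1)%N); lia.
Qed.

Lemma mul_lambda_term (A : comNzRingType) (u v e x s : A) b i k :
  (u * x ^+ k * v * e *+ b) * x ^+ i * s =
  x ^+ (k + i) * ((u * v * e *+ b) * s).
Proof.
rewrite exprD !(mulrnAl, mulrnAr); congr (_ *+ _); ring.
Qed.

Lemma mul_carry (A : comNzRingType) (x q t v u s : A) j e :
  (t + x * v) * x ^+ j * q ^+ e.+1 + (u * x ^+ j.+1 * q ^+ e + s) =
  t * x ^+ j * q ^+ e.+1 + ((u + v * q) * x ^+ j.+1 * q ^+ e + s).
Proof. by rewrite !exprS; ring. Qed.

(* As e j = (e j.+1).+1, the carry v of the j-th digit adds v * q to the      *)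
(* coefficient of x ^+ j.+1.                                                  *)
Lemma carry_digits (A : comNzRingType) (D : A -> Prop) (x q : A)
    (e : nat -> nat) N :
  (forall u, exists t v, D t /\ u = t + x * v) -> x ^+ N = 0 ->
  (forall j, (j.+1 < N)%N -> e j = (e j.+1).+1) ->
  forall U : nat -> A, exists T : nat -> A, (forall k, D (T k)) /\
    \sum_(0 <= k < N) U k * x ^+ k * q ^+ e k =
    \sum_(0 <= k < N) T k * x ^+ k * q ^+ e k.
Proof.
move=> Ddiv xN eE U.
suff carry d j (V : nat -> A) : (j + d = N)%N ->
  exists T : nat -> A, (forall k, D (T k)) /\
    \sum_(j <= k < N) V k * x ^+ k * q ^+ e k =
    \sum_(j <= k < N) T k * x ^+ k * q ^+ e k.
  exact: (carry N 0%N U).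
elim: d j V => [|d IH] j {}U jd.
  have [t [_ [Dt _]]] := Ddiv 0.
  (* The range is empty; dividing 0 only serves to exhibit an element of [D]. *)
  by exists (fun=> t); split=> //; rewrite !big_geq // -jd addn0.
have [t [v [Dt UE]]] := Ddiv (U j).
pose U' k := if k == j.+1 then U k + v * q else U k.
have [|T [DT TE]] := IH j.+1 U'; first by rewrite addSnnS.
exists (fun k => if k == j then t else T k); split=> [k|].
  by case: eqP.
have lt_jN : (j < N)%N by lia.
rewrite !(big_ltn lt_jN) eqxx; set rhs := (X in _ = _ + X).
have {rhs}-> : rhs = \sum_(j.+1 <= k < N) T k * x ^+ k * q ^+ e k.
  by apply: eq_big_nat => k /andP[lt_jk _]; rewrite gtn_eqF.
rewrite -TE UE; have [lt_jN'|le_Nj] := ltnP j.+1 N; last first.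
  (* At the last index the carry is a multiple of [x ^+ N], hence 0. *)
  rewrite !big_geq // !addr0 !mulrDl (mulrAC x) -exprS.
  have -> : j.+1 = N by lia.
  by rewrite xN !mul0r addr0.
rewrite !(big_ltn lt_jN') {1}/U' eqxx (eE _ lt_jN') mul_carry.
congr (_ + (_ + _)); apply: eq_big_nat => k /andP[lt_jk _].
by rewrite /U' gtn_eqF.
Qed.

Lemma mul_pow_term (A : comNzRingType) (u x v : A) i j :
  x ^+ i * (u * x ^+ j * v) = u * x ^+ (i + j) * v.
Proof. by rewrite exprD; ring. Qed.

(** * Base-p/Q representations *)

Section BaseRepresentation.
Variables (p : nat) (P : {poly {poly padic p}}) (Q : laurent (padic p)).
Hypotheses (p_pr : prime p) (P00 : P.[0, 0] = 0).
Hypotheses (dP00 : padic_mod 0 (dY P).[0, 0] != 0) (liftQ : is_lift P Q).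

Let p_gt0 : (0 < p)%N := prime_gt0 p_pr.

Local Notation q n := (laurent_map (padic_mod n) Q).

Lemma lift_coef0 n : (q n)@_(0%N, 0) \is a GRing.unit.
Proof.
rewrite laurent_map_coef /= -(natr_Zp (padic_mod n _)).
rewrite unitZpE ?prime_powS_gt1 // coprime_pexpl // prime_coprime //.
apply: contra dP00 => pQ.
have : Zp_proj p_pr (leq0n n) (padic_mod n Q@_(0%N, 0)) = 0.
  by apply/eqP; rewrite Zp_nat_eq0.
rewrite Zp_proj_padic => Q0.
have [QE _] := liftQ; have := congr1 (mcoeff (0%N, 0 : int)) QE.
rewrite !laurent_map_coef poly_over_y_coef laurent_of_poly_coef /= Q0 => P01.
by rewrite !horner_coef0 /dY coef_map_id0 ?deriv0 // coef_deriv mulr1n P01.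
Qed.

(** Sharing the support of P/y mod p makes these coefficients of Q vanish exactly, not just mod p.
    The critical case j = -1 is P(0, 0) = 0. *)
Lemma lift_coef_neg n (j : int) : j < 0 -> (q n)@_(0%N, j) = 0.
Proof.
move=> j0; rewrite laurent_map_coef mcoeff_outdom ?rmorph0 //.
have [_ ->] := liftQ; rewrite -mcoeff_eq0 laurent_map_coef poly_over_y_coef.
have [j1|j1] := ltrP (j + 1) 0.
  by rewrite laurent_of_poly_coef_neg ?rmorph0.
have -> : j + 1 = 0%N by lia.
move: P00; rewrite laurent_of_poly_coef !horner_coef0 => ->.
by rewrite rmorph0.
Qed.

Lemma lift_expI n e : injective (fun f : laurent 'Z_(p ^ n.+1) => f * q n ^+ e).
Proof.
elim: e => [|e IH] f g; first by rewrite !expr0 !mulr1.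
rewrite !exprS !mulrA => /IH /eqP; rewrite -subr_eq0 -mulrBl => /eqP fg0.
apply/eqP; rewrite -subr_eq0; apply/eqP.
by apply: laurent_lexi_mulI fg0; [apply: lift_coef0 | apply: lift_coef_neg].
Qed.

Lemma poly_over_y_lift n :
  nat_dvd p (laurent_map (padic_mod n) (poly_over_y P) - q n).
Proof.
apply: laurent_nat_dvd => k; apply: (@Zp_proj0_eq0 _ p_pr n).
rewrite mcoeffB !laurent_map_coef rmorphB /= !Zp_proj_padic.
have [QE _] := liftQ; have := congr1 (mcoeff k) QE.
by rewrite !laurent_map_coef => ->; rewrite subrr.
Qed.

Lemma laurent_proj_padic m n (le_mn : (m <= n)%N) (f : laurent (padic p)) :
  laurent_map (Zp_proj p_pr le_mn) (laurent_map (padic_mod n) f) =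
  laurent_map (padic_mod m) f.
Proof. by apply: laurentP => k; rewrite !laurent_map_coef /= Zp_proj_padic. Qed.

Lemma laurent_proj_int m n (le_mn : (m <= n)%N) (f : laurent int) :
  laurent_map (Zp_proj p_pr le_mn) (laurent_map intr f) = laurent_map intr f.
Proof. by apply: laurentP => k; rewrite !laurent_map_coef /= rmorph_int. Qed.

(** Arbitrary coefficients in place of digits make this set closed under addition. *)
Definition in_span n (S : laurent 'Z_(p ^ n.+1)) : Prop :=
  exists U : nat -> laurent 'Z_(p ^ n.+1),
    S = \sum_(0 <= k < n.+1) U k * p%:R ^+ k * q n ^+ (p ^ n - 1 - k).

Lemma laurent_Zp_natX_eq0 n k :
  (n < k)%N -> p%:R ^+ k = 0 :> laurent 'Z_(p ^ n.+1).
Proof.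
move=> lt_nk; apply: (laurent_Zp_pow_nat_dvd p_pr); rewrite -natrX.
by apply: nat_dvd_trans (nat_dvd_nat _ _); rewrite dvdn_exp2l.
Qed.

Lemma in_spanD n (S S' : laurent 'Z_(p ^ n.+1)) :
  in_span S -> in_span S' -> in_span (S + S').
Proof.
move=> [U ->] [V ->]; exists (fun k => U k + V k).
by rewrite -big_split; apply: eq_bigr => k _; rewrite /= !mulrDl.
Qed.

Lemma in_span0 n : in_span (0 : laurent 'Z_(p ^ n.+1)).
Proof. by exists (fun=> 0); rewrite big1 // => k _; rewrite !mul0r. Qed.

Lemma in_span_sum n (I : Type) (s : seq I) (F : I -> laurent 'Z_(p ^ n.+1)) :
  (forall i, in_span (F i)) -> in_span (\sum_(i <- s) F i).
Proof.
by move=> FS; elim/big_ind: _ => //; [apply: in_span0 | apply: in_spanD].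
Qed.

(** No bound on k is imposed, as p^k = 0 for k > n; binomial terms of any order can thus be treated
    alike. *)
Lemma in_span_term n k (U : laurent 'Z_(p ^ n.+1)) :
  in_span (U * p%:R ^+ k * q n ^+ (p ^ n - 1 - k)).
Proof.
have [lt_kn|lt_nk] := ltnP k n.+1; last first.
  by rewrite laurent_Zp_natX_eq0 // mulr0 mul0r; apply: in_span0.
exists (fun i => if i == k then U else 0).
rewrite (bigD1_seq k) ?mem_index_iota ?iota_uniq //= eqxx big1 ?addr0 //.
by move=> i /negbTE ->; rewrite !mul0r.
Qed.

Lemma in_span_initial n : in_span (initial_poly P n).
Proof.
have [E qE] := poly_over_y_lift n.
have PE : laurent_map (padic_mod n) (poly_over_y P) = q n + p%:R * E.
  by rewrite -qE addrC subrK.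
rewrite /initial_poly laurent_mapM (laurent_mapX _ (poly_over_y P)).
rewrite [X in _ * X ^+ _]PE exprDn mulr_sumr.
by apply: in_span_sum => i; rewrite mul_binomial_term; apply: in_span_term.
Qed.

Lemma in_span_lambda n (r : 'I_p) (S : laurent 'Z_(p ^ n.+1)) :
  in_span S -> in_span (lambda Q r S).
Proof.
move=> [U ->]; rewrite /lambda mulr_suml (cartier_sum p_gt0) big_mkord.
apply: in_span_sum => k /=.
have lt_n : (n < p ^ n)%N by rewrite ltn_expl // prime_gt1.
have lt_k := ltn_ord k.
set m := (p ^ n - 1 - k)%N.
(* This isolates (q^p)^m = (q(x^p, y^p) + pF)^m. The Cartier operator turns q(x^p, y^p)^(m - i) into
   q^(m - i), and the accompanying p^(k + i) matches because m - i = p^n - 1 - (k + i). *)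
have eE : (m + (p ^ n.+1 - p ^ n) = (p - 1) * k.+1 + p * m)%N.
  have p1 := prime_gt1 p_pr.
  have : (p ^ n = m + k.+1)%N by rewrite /m; lia.
  by rewrite expnS => ->; nia.
rewrite (mul_exp_split _ _ eE).
have [F qF] := nat_dvd_Zp_subst p_pr (q n).
have {}qF : q n ^+ p = laurent_subst p (q n) + p%:R * F.
  by rewrite -qF addrC subrK.
rewrite qF exprDn !mulr_sumr (cartier_sum p_gt0); apply: in_span_sum => i.
rewrite mul_binomial_term mul_lambda_term.
rewrite (cartier_natXM p_gt0) (cartierM_substX p_gt0) mulrA.
rewrite [p%:R ^+ _ * _]mulrC.
have -> : (m - i = p ^ n - 1 - (k + i))%N by rewrite [RHS]subnDA.
exact: in_span_term.
Qed.

Lemma is_state_in_span n (S : laurent 'Z_(p ^ n.+1)) :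
  is_state P Q S -> in_span S.
Proof.
by elim=> [|r T _]; [apply: in_span_initial | apply: in_span_lambda].
Qed.

Lemma laurent_digit n (U : laurent 'Z_(p ^ n.+1)) :
  exists T V, digit_poly p T /\ U = laurent_map intr T + p%:R * V.
Proof.
pose T : laurent int := [malg k in msupp U => ((U@_k : nat) %% p)%:Z].
have TE k : T@_k = ((U@_k : nat) %% p)%:Z.
  by rewrite mcoeffE; case: ifPn => // /mcoeff_outdom ->; rewrite mod0n.
have [V UT] : nat_dvd p (U - laurent_map intr T).
  apply: laurent_nat_dvd => k; rewrite mcoeffB laurent_map_coef TE /=.
  exists ((U@_k : nat) %/ p)%:R.
  rewrite -{1}(natr_Zp U@_k) {1}(divn_eq U@_k p) natrD natrM addrK.
  exact: mulrC.
exists T, V; split; last by rewrite -UT addrC subrK.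
by move=> k; rewrite TE lez_nat ltz_nat ltn_pmod.
Qed.

Lemma span_base_repr n (S : laurent 'Z_(p ^ n.+1)) :
  in_span S -> exists T : {ffun 'I_n.+1 -> laurent int}, base_repr Q S T.
Proof.
have lt_n : (n < p ^ n)%N by rewrite ltn_expl // prime_gt1.
pose D (t : laurent 'Z_(p ^ n.+1)) :=
  exists T, digit_poly p T /\ t = laurent_map intr T.
have Ddiv u : exists t v, D t /\ u = t + p%:R * v.
  have [T [v [T_digit uE]]] := laurent_digit u.
  by exists (laurent_map intr T), v; split=> //; exists T.
(* The subtraction is exact because j + 1 <= n < p^n. *)
have eE j : (j.+1 < n.+1)%N -> (p ^ n - 1 - j = (p ^ n - 1 - j.+1).+1)%N by lia.
move=> [U ->].
have [T' [/choice[T DT] ->]] :=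
  carry_digits (q n) Ddiv (laurent_Zp_natX_eq0 (ltnSn n)) eE U.
exists [ffun k : 'I_n.+1 => T k]; split=> [k|].
  by rewrite ffunE; case: (DT k).
rewrite big_mkord; apply: eq_bigr => k _.
by rewrite ffunE; case: (DT k) => _ ->.
Qed.

(** The equation says that p divides a - b, whose absolute value is less than p. *)
Lemma Zp_digit_inj n (a b : nat) : (a < p)%N -> (b < p)%N ->
  (p ^ n)%:R * (a%:R - b%:R) = 0 :> 'Z_(p ^ n.+1) -> a = b.
Proof.
wlog le_ba : a b / (b <= a)%N => [hwlog a_lt b_lt ab|a_lt _ /eqP].
  have [/hwlog|/ltnW/hwlog h] := leqP b a; first exact.
  by symmetry; apply: h => //; rewrite -opprB mulrN ab oppr0.
rewrite -natrB // -natrM Zp_nat_eq0 // expnSr dvdn_pmul2l ?expn_gt0 ?p_gt0 //.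
case: (posnP (a - b)) => [|ab_gt0 /(dvdn_leq ab_gt0)]; lia.
Qed.

Lemma digit_poly_inj n (T1 T2 : laurent int) :
  digit_poly p T1 -> digit_poly p T2 ->
  (p ^ n)%:R * (laurent_map intr T1 - laurent_map intr T2)
    = 0 :> laurent 'Z_(p ^ n.+1) ->
  T1 = T2.
Proof.
move=> T1_digit T2_digit T12; apply: laurentP => k.
have := congr1 (mcoeff k) T12; rewrite laurent_natM_coef mcoeff0 mcoeffB.
rewrite !laurent_map_coef /=.
have := T1_digit k; have := T2_digit k; move: T1@_k T2@_k => [a|a] [b|b] //=.
by move=> b_lt a_lt /Zp_digit_inj ->.
Qed.

Lemma base_repr_uniq n (S : laurent 'Z_(p ^ n.+1))
    (T T' : {ffun 'I_n.+1 -> laurent int}) :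
  base_repr Q S T -> base_repr Q S T' -> T = T'.
Proof.
move=> [T_digit TE] [T'_digit T'E]; apply/ffunP => k.
have [d] := ubnP (k : nat); elim: d k => // d IH k kd.
pose D i : laurent 'Z_(p ^ n.+1) :=
  laurent_map intr (T i) - laurent_map intr (T' i).
have D0 : \sum_(i < n.+1) D i * p%:R ^+ i * q n ^+ (p ^ n - 1 - i) = 0.
  rewrite -[RHS](subrr S) {1}TE T'E -sumrB; apply: eq_bigr => i _.
  by rewrite /D !mulrBl.
apply: (@digit_poly_inj n) => //; rewrite natrX mulrC -/(D k).
apply: (@lift_expI n (p ^ n - 1 - k)); rewrite mul0r.
(* The factor p^(n - k) kills the terms beyond k, and those before k vanish by induction; p^n times
   the k-th difference remains, up to a power of q. *)
have := congr1 ( *%R (p%:R ^+ (n - k))) D0; rewrite mulr0 mulr_sumr.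
rewrite (bigD1 k) //= big1 ?addr0 => [<-|i ik].
  by rewrite mul_pow_term subnK // -ltnS.
have [lt_ik|lt_ki|/val_inj ik'] := ltngtP i k; last by rewrite ik' eqxx in ik.
  rewrite /D (IH i) ?subrr ?mul0r ?mulr0 //; lia.
by rewrite mul_pow_term laurent_Zp_natX_eq0 ?mulr0 ?mul0r //; lia.
Qed.

(** * Truncation *)

(** A relation rather than a function: q can be cancelled but need not be invertible, so V is unique
    while its existence has to be proved. *)
Definition reduces m n (le_mn : (m <= n)%N) (S : laurent 'Z_(p ^ n.+1))
    (V : laurent 'Z_(p ^ m.+1)) : Prop :=
  laurent_map (Zp_proj p_pr le_mn) S = V * q m ^+ (p ^ n - p ^ m).

Lemma reduces_uniq m n (le_mn : (m <= n)%N) (S : laurent 'Z_(p ^ n.+1)) V W :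
  reduces le_mn S V -> reduces le_mn S W -> V = W.
Proof. by move=> SV SW; apply: (@lift_expI m (p ^ n - p ^ m)); rewrite -SV. Qed.

Lemma reduces_id n (le_nn : (n <= n)%N) (S : laurent 'Z_(p ^ n.+1)) :
  reduces le_nn S S.
Proof.
rewrite /reduces subnn expr0 mulr1; apply: laurentP => k.
by rewrite laurent_map_coef /= Zp_proj_id.
Qed.

Lemma initial_polyE n : initial_poly P n =
  laurent_map (padic_mod n) (laurent_y _ * laurent_of_poly (dY P)) *
    laurent_map (padic_mod n) (poly_over_y P) ^+ (p ^ n - 1).
Proof. exact: laurent_mapMX. Qed.

Lemma initial_poly_proj m n (le_mn : (m <= n)%N) :
  laurent_map (Zp_proj p_pr le_mn) (initial_poly P n) =
  laurent_map (padic_mod m) (laurent_y _ * laurent_of_poly (dY P)) *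
    laurent_map (padic_mod m) (poly_over_y P) ^+ (p ^ n - 1).
Proof. by rewrite laurent_proj_padic; apply: laurent_mapMX. Qed.

Lemma reduces_initial m n (le_mn : (m <= n)%N) :
  reduces le_mn (initial_poly P n) (initial_poly P m).
Proof.
rewrite /reduces initial_poly_proj initial_polyE.
apply: (mul_exp_initial _ p_gt0 le_mn).
exact: laurent_Zp_expp_eq (poly_over_y_lift m).
Qed.

(** At level m, the surplus power of q equals q(x^p, y^p)^(p^n - p^m), which leaves the Cartier
    operator as q^(p^n - p^m). *)
Lemma reduces_lambda m n (le_mn : (m <= n)%N) r (S : laurent 'Z_(p ^ n.+1)) V :
  reduces le_mn S V -> reduces le_mn (lambda Q r S) (lambda Q r V).
Proof.
move=> SV; rewrite /reduces /lambda (cartier_map p_gt0).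
rewrite (laurent_mapMX _ S (q n)) [laurent_map _ S]SV.
rewrite (laurent_proj_padic le_mn Q).
have qs := laurent_Zp_expp_eq p_pr (nat_dvd_Zp_subst p_pr (q m)).
rewrite -(cartierM_substX p_gt0).
exact: (congr1 (@cartier p r _) (mul_exp_lambda V p_gt0 le_mn qs)).
Qed.

Lemma reduces_trans l m n (le_lm : (l <= m)%N) (le_mn : (m <= n)%N)
    (le_ln : (l <= n)%N) S V W :
  reduces le_mn S V -> reduces le_lm V W -> reduces le_ln S W.
Proof.
rewrite /reduces => SV VW.
have -> : laurent_map (Zp_proj p_pr le_ln) S =
    laurent_map (Zp_proj p_pr le_lm) (laurent_map (Zp_proj p_pr le_mn) S).
  apply: laurentP => k.
  by rewrite !laurent_map_coef /= (Zp_proj_comp p_pr _ _ le_ln).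
rewrite SV laurent_mapM laurent_mapX VW laurent_proj_padic -mulrA -exprD.
congr (_ * _ ^+ _).
have := leq_pexp2l p_gt0 le_lm; have := leq_pexp2l p_gt0 le_mn; lia.
Qed.

(** The terms with k > m vanish mod p^(m+1); the others share the factor q^(p^n - p^m), which is
    cancelled. *)
Lemma reduces_base_repr m n (le_mn : (m <= n)%N) (S : laurent 'Z_(p ^ n.+1)) V
    (T : {ffun 'I_n.+1 -> laurent int}) :
  reduces le_mn S V -> base_repr Q S T ->
  base_repr Q V
    [ffun k : 'I_m.+1 => T (widen_ord (le_mn : (m.+1 <= n.+1)%N) k)].
Proof.
move=> SV [T_digit SE]; split=> [k|]; first by rewrite ffunE.
apply: (@lift_expI m (p ^ n - p ^ m)); rewrite -SV SE.
rewrite laurent_map_sum mulr_suml.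
(* Indexing by [nat] through [inord] lets the sum up to m be compared with the sum up to n. *)
pose G k := laurent_map intr (T (inord k)) * p%:R ^+ k * q m ^+ (p ^ n - 1 - k).
transitivity (\sum_(k < m.+1) G k); last first.
  apply: eq_bigr => k _; rewrite ffunE /G.
  have -> : inord k = widen_ord (le_mn : (m.+1 <= n.+1)%N) k.
    by apply: val_inj; rewrite /= inordK // (leq_trans (ltn_ord k)).
  rewrite -[RHS]mulrA -exprD; congr (_ * _ ^+ _).
  have lt_m : (m < p ^ m)%N by rewrite ltn_expl // prime_gt1.
  have := leq_pexp2l p_gt0 le_mn; have := ltn_ord k; lia.
rewrite (big_ord_widen n.+1 G) // [RHS]big_mkcond; apply: eq_bigr => k _.
rewrite laurent_map_term laurent_proj_padic.
case: ifP => [_|/negbT]; last first.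
  rewrite -leqNgt => lt_mk.
  by rewrite (laurent_Zp_natX_eq0 lt_mk) mulr0 mul0r.
rewrite laurent_proj_int /G inord_val; reflexivity.
Qed.

Lemma state_eq n (s t : state (state_automaton P Q n)) :
  proj1_sig s = proj1_sig t -> s = t.
Proof. by case: s t => [S Ss] [T Ts] /= ST; apply: eq_exist. Qed.

(** Induction on reachability: t is reached at level m by a word that reaches s at level n. *)
Lemma reduces_state m n (le_mn : (m <= n)%N)
    (s : state (state_automaton P Q n)) :
  exists t : state (state_automaton P Q m),
    reduces le_mn (proj1_sig s) (proj1_sig t).
Proof.
case: s => S /=; elim=> [|r {}S _ [t St]].
  by exists (initial (state_automaton P Q m)); apply: reduces_initial.
by exists (@Defs.next p (state_automaton P Q m) r t); apply: reduces_lambda.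
Qed.

Definition truncate m n (le_mn : (m <= n)%N)
    (s : state (state_automaton P Q n)) : state (state_automaton P Q m) :=
  sval (cid (reduces_state le_mn s)).

Lemma truncateP m n (le_mn : (m <= n)%N) s :
  reduces le_mn (proj1_sig s) (proj1_sig (truncate le_mn s)).
Proof. exact: svalP (cid (reduces_state le_mn s)). Qed.

Lemma truncateE m n (le_mn : (m <= n)%N) s t :
  reduces le_mn (proj1_sig s) (proj1_sig t) -> truncate le_mn s = t.
Proof. by move=> st; apply/state_eq/(reduces_uniq (truncateP le_mn s)). Qed.

Lemma truncate_initial m n (le_mn : (m <= n)%N) :
  truncate le_mn (initial (state_automaton P Q n)) =
  initial (state_automaton P Q m).
Proof. exact/truncateE/reduces_initial. Qed.

Lemma truncate_next m n (le_mn : (m <= n)%N) r s :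
  truncate le_mn (Defs.next r s) = Defs.next r (truncate le_mn s).
Proof. exact/truncateE/reduces_lambda/truncateP. Qed.

Definition truncation m n (le_mn : (m <= n)%N) :
    automaton_hom (state_automaton P Q n) (state_automaton P Q m) :=
  AutomatonHom (truncate_initial le_mn) (truncate_next le_mn).

Lemma truncation_is_truncation m n (le_mn : (m <= n)%N) :
  is_truncation le_mn (truncation le_mn).
Proof. by move=> s T; apply/reduces_base_repr/truncateP. Qed.

Lemma truncation_is_inverse_system : is_inverse_system truncation.
Proof.
split=> [n le_nn s|l m n le_lm le_mn le_ln s]; first exact/truncateE/reduces_id.
by apply/esym/truncateE/(reduces_trans _ (truncateP le_mn s))/truncateP.
Qed.

Lemma state_base_repr n (s : state (state_automaton P Q n)) :
  exists! T : {ffun 'I_n.+1 -> laurent int}, base_repr Q (proj1_sig s) T.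
Proof.
have [T ST] := span_base_repr (is_state_in_span (proj2_sig s)).
by exists T; split=> // T'; apply: base_repr_uniq.
Qed.

(** The k-th digit is read at level k, where it is the top one; coherence and uniqueness identify it
    with the k-th digit at every level n >= k. *)
Lemma limit_digits (s : forall n, state (state_automaton P Q n)) :
  (forall m n (le_mn : (m <= n)%N), truncation le_mn (s n) = s m) ->
  exists d : nat -> laurent int,
    forall n, base_repr Q (proj1_sig (s n)) [ffun k : 'I_n.+1 => d k].
Proof.
move=> s_coh.
pose T n := sval (cid (state_base_repr (s n))).
have sT n : base_repr Q (proj1_sig (s n)) (T n).
  by rewrite /T; case: cid => ? [].
exists (fun k => T k ord_max) => n.
suff -> : [ffun k : 'I_n.+1 => T k ord_max] = T n by [].
apply/ffunP => k; rewrite ffunE.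
have le_kn : (k <= n)%N by rewrite -ltnS.
have := truncation_is_truncation le_kn (sT n); rewrite s_coh => /base_repr_uniq.
move=> /(_ _ (sT k)) <-; rewrite ffunE; congr (T n _).
exact: val_inj.
Qed.

End BaseRepresentation.

(** * The inverse limit *)

Section InverseLimit.
Variables (p : nat) (A : nat -> automaton p).
Variable f : forall m n, (m <= n)%N -> automaton_hom (A n) (A m).

Definition coherent (s : forall n, state (A n)) : Prop :=
  forall m n (le_mn : (m <= n)%N), f le_mn (s n) = s m.

Fact coherent_initial : coherent (fun n => initial (A n)).
Proof. by move=> m n le_mn; apply: hom_initial. Qed.

Fact coherent_next r s : coherent s -> coherent (fun n => Defs.next r (s n)).
Proof. by move=> s_coh m n le_mn; rewrite hom_next s_coh. Qed.

Definition limit : automaton p :=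
  @Automaton p {s | coherent s} (exist _ _ coherent_initial)
    (fun r s => exist _ _ (coherent_next r (proj2_sig s))).

Lemma limit_state_eq (s t : state limit) :
  (forall n, proj1_sig s n = proj1_sig t n) -> s = t.
Proof.
case: s t => [s s_coh] [t t_coh] /= st; apply: eq_exist.
exact: functional_extensionality_dep.
Qed.

Definition limit_proj n : automaton_hom limit (A n) :=
  @AutomatonHom p limit (A n) (fun s => proj1_sig s n) erefl (fun _ _ => erefl).

Lemma limit_is_inverse_limit : is_inverse_limit f limit_proj.
Proof.
split=> [m n le_mn [s s_coh]|B g g_cone]; first exact: s_coh.
pose u (b : state B) : state limit :=
  exist coherent (fun n => g n b) (fun m n le_mn => g_cone m n le_mn b).
have u_initial : u (initial B) = initial limit.
  by apply: limit_state_eq => n; apply: hom_initial.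
have u_next r b : u (Defs.next r b) = Defs.next r (u b).
  by apply: limit_state_eq => n; apply: hom_next.
exists (AutomatonHom u_initial u_next); split=> // v v_g b.
by apply: limit_state_eq => n; apply: v_g.
Qed.
End InverseLimit.

(* MathComp world. The index n : nat stands for the exponent alpha = n + 1. *)
Theorem corollary21 (p : nat) (P : {poly {poly padic p}})
    (Q : laurent (padic p)) :
  prime p ->
  P.[0, 0] = 0 ->
  padic_mod 0 (dY P).[0, 0] != 0 ->
  is_lift P Q ->
  (forall n (s : state (state_automaton P Q n)),
     exists! T : {ffun 'I_n.+1 -> laurent int}, base_repr Q (proj1_sig s) T) /\
  exists f : forall m n, (m <= n)%N ->
      automaton_hom (state_automaton P Q n) (state_automaton P Q m),
    [/\ forall m n (le_mn : (m <= n)%N), is_truncation le_mn (f m n le_mn),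
        is_inverse_system f &
        exists (L : automaton p)
               (pi : forall n, automaton_hom L (state_automaton P Q n)),
          is_inverse_limit f pi /\
          exists digits : state L -> nat -> laurent int,
            injective digits /\
            forall s n, base_repr Q (proj1_sig (pi n s))
                          [ffun k : 'I_n.+1 => digits s k]].
Proof.
move=> p_pr P00 dP00 liftQ.
split; first exact: state_base_repr p_pr P00 dP00 liftQ.
pose f := truncation p_pr P00 dP00 liftQ.
exists f; split.
- exact: truncation_is_truncation.
- exact: truncation_is_inverse_system.
exists (limit f), (limit_proj f); split; first exact: limit_is_inverse_limit.
have /choice[digits digitsP] : forall s : state (limit f),
    exists d : nat -> laurent int, forall n,
      base_repr Q (proj1_sig (limit_proj f n s)) [ffun k : 'I_n.+1 => d k].
  by move=> [s s_coh]; apply: limit_digits s_coh.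
(* Injectivity: at each level the state is the sum given by its digits, so equal digit sequences
   give equal components. *)
exists digits; split=> // s t st; apply: limit_state_eq => n; apply: state_eq.
have [_ sE] := digitsP s n; have [_ tE] := digitsP t n.
by rewrite -[LHS]/(proj1_sig (limit_proj f n s)) sE st -tE.
Qed.
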